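(* $\mathrm{Space}(\mathrm{Ordering}_n)=\Omega(n)$, where $\mathrm{Space}$ denotes $\mathrm{Res}(\oplus)$ space.
   Context: $\mathrm{Ordering}_n$ is the CNF in the variables $(x_{ij})_{i\neq j\in[n]}$ consisting of: $\neg x_{ij}\lor\neg x_{ji}$ and $x_{ij}\lor x_{ji}$ for $i\neq j$; $\neg x_{ij}\lor\neg x_{jk}\lor x_{ik}$ for distinct $i,j,k$; $\bigvee_{j\in[n]\setminus\{i\}} x_{ji}$ for each $i\in[n]$. It is viewed as a linear CNF by writing $x$ as $(x=1)$, $\neg x$ as $(x=0)$. $\mathrm{Res}(\oplus)$: linear clauses are disjunctions of equations $f=\alpha$ ($f$ a linear form over $\mathbb{F}_2$, $\alpha\in\{0,1\}$); rules: from $A\lor(f=0)$ and $B\lor(f=1)$ derive $A\lor B$, and from $C$ derive any linear clause semantically implied by $C$. A refutation is a sequence of configurations (sets of linear clauses) $S_1=\emptyset,\dots,S_m$ with $S_m$ containing the empty clause, each obtained from the previous by adding a formula clause, erasing a clause, or adding a clause derived by the rules from current clauses; space is $\max_i|S_i|$, and $\mathrm{Space}$ of a formula is the minimum over its refutations. *)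

(* Defs.v *)
From mathcomp Require Import all_boot all_order all_algebra.
From mathcomp Require Import boolp.

Set Implicit Arguments.
Unset Strict Implicit.
Unset Printing Implicit Defensive.

Local Open Scope ring_scope.

Section ResLin.
Variable V : finType.

(* The literal (v, b) is v when b = true and its negation when b = false;
   a clause is the disjunction of its elements, a CNF the conjunction. *)
Definition literal : finType := (V * bool)%type.
Definition clause : finType := {set literal}.
Definition cnf : finType := {set clause}.

(* The form f stands for \sum_v f v * v, and (f, alpha) for f = alpha. *)
Definition linform : finType := {ffun V -> 'F_2}.
Definition lineq : finType := (linform * 'F_2)%type.
Definition linclause : finType := {set lineq}.
Definition lincnf : finType := {set linclause}.

Definition lineq_of_literal (l : literal) : lineq :=
  ([ffun v => (v == l.1)%:R], (l.2 : nat)%:R).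

Definition linclause_of_clause (C : clause) : linclause :=
  [set lineq_of_literal l | l in C].

Definition lincnf_of_cnf (F : cnf) : lincnf :=
  [set linclause_of_clause C | C in F].

Definition assignment : finType := {ffun V -> 'F_2}.

Definition lineq_sat (a : assignment) (e : lineq) : bool :=
  \sum_v e.1 v * a v == e.2.

Definition linclause_sat (a : assignment) (C : linclause) : bool :=
  [exists e in C, lineq_sat a e].

Definition implies (C D : linclause) : bool :=
  [forall a, linclause_sat a C ==> linclause_sat a D].

Definition config : finType := {set linclause}.

Definition resolves (S : config) (C : linclause) : bool :=
  [exists f : linform, exists A : linclause, exists B : linclause,
    [&& (f, 0) |: A \in S, (f, 1) |: B \in S & C == A :|: B]].

Definition weakens (S : config) (C : linclause) : bool :=
  [exists D in S, implies D C].

Definition step (F : lincnf) (S T : config) : bool :=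
  [|| [exists C in F, T == C |: S],
      [exists C in S, T == S :\ C]
    | [exists C, (resolves S C || weakens S C) && (T == C |: S)]].

(* s lists the configurations that follow the initial empty one. *)
Definition refutation (F : lincnf) (s : seq config) : bool :=
  path (step F) set0 s && (set0 \in last set0 s).

Definition refutation_space (s : seq config) : nat :=
  \max_(S <- set0 :: s) #|S|.

Definition refutable_in_space (F : lincnf) (k : nat) : Prop :=
  exists2 s : seq config, refutation F s & refutation_space s = k.

(* The minimum of refutation_space, or 0 when F has no refutation. *)
Definition ResLinSpace (F : lincnf) : nat :=
  if pselect (exists k, `[< refutable_in_space F k >]) is left ex
  then ex_minn ex else 0%N.

Lemma ResLinSpaceP (F : lincnf) (s : seq config) : refutation F s ->
  refutable_in_space F (ResLinSpace F) /\
  forall m, refutable_in_space F m -> (ResLinSpace F <= m)%N.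
Proof.
move=> Fs; rewrite /ResLinSpace; case: pselect => [ex|[]].
  case: ex_minnP => k /asboolP Fk kmin.
  by split=> // m Fm; apply: kmin; apply/asboolP.
by exists (refutation_space s); apply/asboolP; exists s.
Qed.

End ResLin.

Section Ordering.
Variable n : nat.

Definition ordvar : finType := {p : 'I_n * 'I_n | p.1 != p.2}.

Definition xvar (i j : 'I_n) (ij : i != j) : ordvar :=
  exist (fun p : 'I_n * 'I_n => p.1 != p.2) (i, j) ij.

Definition poslit (v : ordvar) : literal ordvar := (v, true).
Definition neglit (v : ordvar) : literal ordvar := (v, false).

Variant ordering_clause : clause ordvar -> Prop :=
| Ordering_antisym i j (ij : i != j) (ji : j != i) :
    ordering_clause [set neglit (xvar ij); neglit (xvar ji)]
| Ordering_total i j (ij : i != j) (ji : j != i) :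
    ordering_clause [set poslit (xvar ij); poslit (xvar ji)]
| Ordering_trans i j k (ij : i != j) (jk : j != k) (ik : i != k) :
    ordering_clause [set neglit (xvar ij); neglit (xvar jk); poslit (xvar ik)]
| Ordering_pred i :
    ordering_clause [set poslit v | v : ordvar & (val v).2 == i].

Definition Ordering : cnf ordvar := [set C | `[< ordering_clause C >]].

End Ordering.

(* Main.v *)
Require Import Defs.
From mathcomp Require Import all_boot all_order all_algebra.
From mathcomp Require Import boolp.
Import Order.TTheory GRing.Theory Num.Theory.

(**
  The invariant is that the current configuration is satisfied by some strict
  total order of [n]; it can only fail when the clause "i has a predecessor" is
  downloaded while i is the minimum. Choose in each of the k clauses in memory
  one equation satisfied by the order. Moving a set Y of elements to the front
  (keeping the relative order inside Y and outside Y) makes every variable x_ab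
  a polynomial of degree at most 2 in the indicator of Y, so the chosen
  equations become k quadratic equations in n - 1 variables with the solution
  Y = 0. By a Chevalley-Warning parity argument there is a nonzero solution as
  soon as 2k < n - 1, and in the corresponding order i is no longer minimal.
  Hence every refutation contains a configuration with 2k >= n - 1 clauses.
  A refutation exists because the formula is unsatisfiable, so the minimum
  defining the space is not the junk value 0.
*)

Set Implicit Arguments.
Unset Strict Implicit.
Unset Printing Implicit Defensive.

Local Open Scope ring_scope.

(** * Low-degree functions over ['F_2] and the parity argument *)

Lemma F2P (x : 'F_2) : x = 0 \/ x = 1.
Proof. by case: x => [[|[|]]] // ?; [left | right]; apply/val_inj. Qed.

Lemma addF2xx (x : 'F_2) : x + x = 0.
Proof. by case: (F2P x) => ->; apply/val_inj. Qed.

Section LowDegree.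
Variable I : finType.

(** These are the polynomials of degree at most [d] in the indicator of [Y], encoded without
    monomials as sums of functions of at most [d] coordinates. *)
Inductive low_degree (d : nat) : ({set I} -> 'F_2) -> Prop :=
| LowDegreeJunta (S : {set I}) f :
    (#|S| <= d)%N -> (forall Y, f Y = f (Y :&: S)) -> low_degree d f
| LowDegreeAdd f g :
    low_degree d f -> low_degree d g -> low_degree d (fun Y => f Y + g Y).

Lemma low_degree_const d c : low_degree d (fun=> c).
Proof. by apply: (@LowDegreeJunta d set0); rewrite ?cards0. Qed.

Lemma low_degree_mul d e f g : low_degree d f -> low_degree e g ->
  low_degree (d + e) (fun Y => f Y * g Y).
Proof.
move=> df; elim: df g => {f} [S f Sd fS|f1 f2 _ IH1 _ IH2] g eg.
  elim: eg => {g} [S' g Se gS|g1 g2 _ IH1 _ IH2].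
    apply: (@LowDegreeJunta _ (S :|: S')) => [|Y].
      by rewrite (leq_trans (leq_card_setU S S'))// leq_add.
    rewrite fS gS [in RHS]fS [in RHS]gS -!setIA.
    by rewrite (setUC S) setUK (setUC S') setUK.
  rewrite (_ : (fun Y => _) = fun Y => f Y * g1 Y + f Y * g2 Y).
    exact: LowDegreeAdd.
  by apply/funext => Y; rewrite mulrDr.
rewrite (_ : (fun Y => _) = fun Y => f1 Y * g Y + f2 Y * g Y).
  by apply: LowDegreeAdd; [exact: IH1 | exact: IH2].
by apply/funext => Y; rewrite mulrDl.
Qed.

Lemma low_degree_sum d (J : Type) (r : seq J) (F : J -> {set I} -> 'F_2) :
  (forall j, low_degree d (F j)) ->
  low_degree d (fun Y => \sum_(j <- r) F j Y).
Proof.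
move=> dF; elim: r => [|j r IHr].
  rewrite (_ : (fun Y => _) = fun=> 0); first exact: low_degree_const.
  by apply/funext => Y; rewrite big_nil.
rewrite (_ : (fun Y => _) = fun Y => F j Y + \sum_(k <- r) F k Y).
  exact: LowDegreeAdd.
by apply/funext => Y; rewrite big_cons.
Qed.

Lemma low_degree_prod d (J : Type) (r : seq J) (F : J -> {set I} -> 'F_2) :
  (forall j, low_degree d (F j)) ->
  low_degree (d * size r) (fun Y => \prod_(j <- r) F j Y).
Proof.
move=> dF; elim: r => [|j r IHr].
  rewrite (_ : (fun Y => _) = fun=> 1); first exact: low_degree_const.
  by apply/funext => Y; rewrite big_nil.
rewrite (_ : (fun Y => _) = fun Y => F j Y * \prod_(k <- r) F k Y) /= ?mulnS.
  exact: low_degree_mul.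
by apply/funext => Y; rewrite big_cons.
Qed.

(* A junta on S ignores some coordinate i outside S, so the values at Y and
   i |: Y cancel in characteristic 2. *)
Lemma sum_low_degree d f : (d < #|I|)%N -> low_degree d f -> \sum_Y f Y = 0.
Proof.
move=> dI; elim=> {f} [S f Sd fS|f g _ IHf _ IHg]; last first.
  by rewrite big_split /= IHf IHg addr0.
have /existsP[i iS] : [exists i, i \notin S].
  rewrite -negb_forall; apply: contraL (leq_ltn_trans Sd dI) => /forallP SI.
  by rewrite -leqNgt -cardsT subset_leq_card//; apply/subsetP => x _.
rewrite (bigID (fun Y : {set I} => i \in Y)) /=.
rewrite (reindex_onto (fun Y => i |: Y) (fun Y => Y :\ i)) /=; last first.
  by move=> Y iY; rewrite setD1K.
rewrite (eq_big (fun Y : {set I} => i \notin Y) f) ?addF2xx// => Y.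
  rewrite setU11 /=; apply/eqP/idP => [<-|iY]; first by rewrite !inE eqxx.
  by rewrite setU1K.
move=> _; rewrite fS [in RHS]fS; congr f; apply/setP => x; rewrite !inE.
by have [->|] := eqVneq x i; rewrite //= (negPf iS) !andbF.
Qed.

(** If [X] were the only point of the support, the vanishing sum of all values would equal [f X]. *)
Lemma low_degree_support d f X : (d < #|I|)%N -> low_degree d f -> f X != 0 ->
  exists2 Y, Y != X & f Y != 0.
Proof.
move=> dI df fX0; apply/exists_inP; apply: contraNT fX0.
rewrite negb_exists_in => /forall_inP f0.
move: (sum_low_degree dI df); rewrite (bigD1 X)//= big1 ?addr0 => [->//|Y YX].
by have := f0 _ YX; rewrite negbK => /eqP.
Qed.

End LowDegree.

(** * Moving a set of elements to the front of a strict total order *)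

Section Orders.

Definition strict_total (T : eqType) (lt : rel T) :=
  [/\ irreflexive lt, transitive lt & forall x y, x != y -> lt x y || lt y x].

Definition promote (T : finType) (lt : rel T) (Y : {set T}) : rel T :=
  fun x y => if (x \in Y) == (y \in Y) then lt x y else x \in Y.

Lemma promote_strict_total (T : finType) (lt : rel T) (Y : {set T}) :
  strict_total lt -> strict_total (promote lt Y).
Proof.
case=> irr tr tot; split=> [x|y x z|x y xy]; rewrite /promote.
- by rewrite eqxx.
- have := tr y x z.
  by case: (x \in Y); case: (y \in Y); case: (z \in Y) => //= H /H.
- by have := tot _ _ xy; case: (x \in Y); case: (y \in Y).
Qed.

Lemma promote0 (T : finType) (lt : rel T) : promote lt set0 = lt.
Proof. by apply/funext => x; apply/funext => y; rewrite /promote !inE. Qed.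

Variable n : nat.

Definition order_assignment (lt : rel 'I_n) : assignment (ordvar n) :=
  [ffun v => (lt (val v).1 (val v).2)%:R].

(** Whether [a] precedes [b] after the promotion depends only on the membership of [a] and [b] in
    [Y]. *)
Lemma low_degree_promote (lt : rel 'I_n) v :
  low_degree 2 (fun Y => order_assignment (promote lt Y) v).
Proof.
apply: (@LowDegreeJunta _ _ [set (val v).1; (val v).2]) => [|Y].
  by rewrite cards2; case: eqP.
by rewrite !ffunE /promote !inE !eqxx ?orbT !andbT.
Qed.

(** Writing the truth value as an affine function of the form shows that its degree is no larger
    than that of the variables. *)
Lemma lineq_satE (V : finType) (a : assignment V) (e : lineq V) :
  (lineq_sat a e)%:R = 1 + e.2 + \sum_v e.1 v * a v :> 'F_2.
Proof.
rewrite /lineq_sat; move: (\sum_v _) => s.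
by case: (F2P s) => ->; case: (F2P e.2) => ->; apply/val_inj.
Qed.

Lemma low_degree_lineq_sat (lt : rel 'I_n) e :
  low_degree 2 (fun Y => (lineq_sat (order_assignment (promote lt Y)) e)%:R).
Proof.
rewrite (_ : (fun Y => _) = fun Y => 1 + e.2 +
  \sum_v e.1 v * order_assignment (promote lt Y) v).
  apply: LowDegreeAdd; first exact: low_degree_const.
  apply: low_degree_sum => v.
  by apply: (@low_degree_mul _ 0); [exact: low_degree_const
                                   |exact: low_degree_promote].
by apply/funext => Y; rewrite lineq_satE.
Qed.

Lemma order_avoid_minimum (S : config (ordvar n)) (lt : rel 'I_n) (i : 'I_n) :
    (2 * #|S| < n.-1)%N -> strict_total lt ->
    (forall C, C \in S -> linclause_sat (order_assignment lt) C) ->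
  exists lt', [/\ strict_total lt',
    forall C, C \in S -> linclause_sat (order_assignment lt') C
    & exists j, lt' j i].
Proof.
move=> Sn ltT satS.
(* The chosen satisfied equation of [C]; the default [(0, 0)] is never reached for [C] in [S]. *)
pose c (C : linclause (ordvar n)) :=
  odflt (0, 0) [pick e in C | lineq_sat (order_assignment lt) e].
have cP C : C \in S -> c C \in C /\ lineq_sat (order_assignment lt) (c C).
  move=> /satS /exists_inP[e eC sat_e]; rewrite /c.
  by case: pickP => [e' /andP[]//|/(_ e)]; rewrite eC sat_e.
have [/existsP[j ji]|_] := boolP [exists j, lt j i].
  by exists lt; split=> //; exists j.
(* [f] is the indicator of the sets [Y] that leave [i] in place and keep all chosen equations true.
   The first factor has degree 1, each other factor degree 2. *)
pose f (Y : {set 'I_n}) : 'F_2 := (i \notin Y)%:R *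
  \prod_(C <- enum S) (lineq_sat (order_assignment (promote lt Y)) (c C))%:R.
have df : low_degree (1 + 2 * size (enum S)) f.
  apply: low_degree_mul; last first.
    by apply: low_degree_prod => C; exact: low_degree_lineq_sat.
  apply: (@LowDegreeJunta _ _ [set i]); first by rewrite cards1.
  by move=> Y; rewrite !inE eqxx andbT.
(* The degree is below [n] by the bound on [S], and [f set0] is 1 because promoting nothing gives
   back [lt]. *)
have [||Y Y0] := @low_degree_support _ _ f set0 _ df.
- by rewrite -cardE card_ord add1n -ltn_predRL.
- rewrite /f inE mul1r big_seq big1 ?oner_eq0// => C.
  by rewrite mem_enum promote0 => /cP[_ ->].
rewrite /f; have [|iY] := boolP (i \in Y); first by rewrite mul0r eqxx.
rewrite mul1r => prodY; exists (promote lt Y); split=> [|C CS|].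
- exact: promote_strict_total.
- apply/exists_inP; exists (c C); first by case: (cP C CS).
  apply: contraNT prodY => /negPf unsat.
  by rewrite (big_rem C) ?mem_enum//= unsat mul0r.
(* Any promoted element precedes [i], which was not promoted. *)
- have /set0Pn[j jY] := Y0; exists j.
  by rewrite /promote jY (negPf iY).
Qed.

End Orders.

(** * Clauses and their linear translations *)

Section Literals.
Variable V : finType.
Implicit Types (a : assignment V) (l : literal V) (C : clause V).

Definition clause_sat a C := [exists l in C, a l.1 == (l.2 : nat)%:R].

Lemma lineq_sat_unit a v b :
  lineq_sat a ([ffun w => (w == v)%:R], b) = (a v == b).
Proof.
rewrite /lineq_sat (bigD1 v)//= ffunE eqxx mul1r big1 ?addr0// => w /negPf wv.
by rewrite ffunE wv mul0r.
Qed.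

Lemma linclause_of_clauseP a C :
  linclause_sat a (linclause_of_clause C) = clause_sat a C.
Proof.
apply/exists_inP/exists_inP => [[_ /imsetP[l lC ->]]|[l lC al]].
  by rewrite lineq_sat_unit => ?; exists l.
by exists (lineq_of_literal l); rewrite ?imset_f// lineq_sat_unit.
Qed.

End Literals.

(** * Soundness of the proof steps *)

Section Soundness.
Variable V : finType.
Implicit Types (a : assignment V) (F : lincnf V) (S T : config V).

Definition config_sat a S := [forall C in S, linclause_sat a C].

Lemma config_satU1 a C S :
  config_sat a (C |: S) = linclause_sat a C && config_sat a S.
Proof.
apply/forall_inP/andP => [aCS|[aC /forall_inP aS] D /setU1P[->//|/aS//]].
split; first by apply: aCS; rewrite setU11.
by apply/forall_inP => D DS; apply: aCS; rewrite setU1r.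
Qed.

Lemma resolves_sound a S C :
  resolves S C -> config_sat a S -> linclause_sat a C.
Proof.
move=> /existsP[f /existsP[A /existsP[B /and3P[fA fB /eqP->]]]] /forall_inP aS.
have /exists_inP[e /setU1P[->|eA] ae] := aS _ fA; last first.
  by apply/exists_inP; exists e; rewrite ?inE ?eA.
have /exists_inP[e' /setU1P[->|eB] ae'] := aS _ fB; last first.
  by apply/exists_inP; exists e'; rewrite ?inE ?eB ?orbT.
by move: ae ae'; rewrite /lineq_sat /= => /eqP->; rewrite eq_sym oner_eq0.
Qed.

Lemma weakens_sound a S C :
  weakens S C -> config_sat a S -> linclause_sat a C.
Proof.
move=> /exists_inP[D DS /forallP/(_ a)/implyP DC] /forall_inP aS.
exact/DC/aS.
Qed.

(** Erasure and inference preserve satisfaction, so the download of a formula clause is the only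
    case left open. *)
Lemma config_sat_step a F S T : step F S T -> config_sat a S ->
  config_sat a T \/ exists2 C, C \in F & T = C |: S.
Proof.
case/or3P => [/exists_inP[C CF /eqP->]|/exists_inP[C CS /eqP->]|].
- by right; exists C.
- move=> /forall_inP aS; left; apply/forall_inP => D /setD1P[_]; exact: aS.
- move=> /existsP[C /andP[SC /eqP->]] aS; left; rewrite config_satU1 aS andbT.
  by case/orP: SC => [/resolves_sound|/weakens_sound]; exact.
Qed.

End Soundness.

(** * Completeness: unsatisfiable formulas have refutations *)

Section Completeness.
Variables (V : finType) (F : lincnf V).

(** Starting from an arbitrary [S] and never losing it lets derivations be concatenated. *)
Definition derivable C := forall S, exists s,
  [/\ path (step F) S s, S \subset last S s & C \in last S s].

Lemma derivable_axiom C : C \in F -> derivable C.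
Proof.
move=> CF S; exists [:: C |: S]; split=> /=; rewrite ?setU11 ?subsetU1//.
by rewrite andbT; apply/or3P/Or31/exists_inP; exists C.
Qed.

Lemma derivable_resolve (f : linform V) (A : linclause V) :
  derivable ((f, 0) |: A) -> derivable ((f, 1) |: A) -> derivable A.
Proof.
move=> d0 d1 S; have [s [ps Ss s0]] := d0 S.
have [t [pt st t1]] := d1 (last S s).
exists (rcons (s ++ t) (A |: last S (s ++ t))).
rewrite last_rcons rcons_path cat_path last_cat ps pt setU11 /=; split=> //.
  apply/or3P/Or33/existsP; exists A; rewrite eqxx andbT; apply/orP; left.
  apply/existsP; exists f; apply/existsP; exists A; apply/existsP; exists A.
  by rewrite (subsetP st)// t1 setUid eqxx.
by apply: subset_trans (subsetUr _ _); apply: subset_trans st.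
Qed.

Lemma derivable_weaken (C D : linclause V) :
  derivable C -> Defs.implies C D -> derivable D.
Proof.
move=> dC CD S; have [s [ps Ss Cs]] := dC S; exists (rcons s (D |: last S s)).
rewrite last_rcons rcons_path ps setU11 /=; split=> //.
  apply/or3P/Or33/existsP; exists D; rewrite eqxx andbT; apply/orP; right.
  by apply/exists_inP; exists C.
exact: subset_trans (subsetUr _ _).
Qed.

(* The negation of the partial assignment a restricted to U. *)
Definition negated_assignment (a : assignment V) (U : {set V}) : linclause V :=
  [set ([ffun w => (w == v)%:R], a v + 1) | v in U].

Lemma sat_negated_assignment (a b : assignment V) U :
  ~~ linclause_sat b (negated_assignment a U) -> {in U, b =1 a}.
Proof.
move=> /exists_inPn nb v vU; have := nb _ (imset_f _ vU).
rewrite lineq_sat_unit.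
by case: (F2P (a v)) => ->; case: (F2P (b v)) => ->.
Qed.

(** Induction on the number of variables outside [U], as in a full decision tree: at a leaf [a]
    falsifies a clause of [F], and at an inner node the clauses of the two children are resolved. *)
Lemma derivable_negated_assignment (a : assignment V) (U : {set V}) :
  (forall a, ~~ config_sat a F) -> derivable (negated_assignment a U).
Proof.
move=> unsatF; have [m] := ubnP #|~: U|; elim: m => // m IHm in a U *.
move=> Um; have [U0|/set0Pn[v]] := eqVneq (~: U) set0.
  have /forall_inPn[C CF Ca] := unsatF a.
  (* Only [a] falsifies the negated total assignment, and [a] falsifies [C], so [C] implies it. *)
  apply: derivable_weaken (derivable_axiom CF) _; apply/forallP => b.
  apply/implyP => Cb; apply: contraNT Ca => /sat_negated_assignment ab.
  rewrite (_ : a = b)//; apply/ffunP => v; rewrite ab//.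
  by move/setP/(_ v): U0; rewrite !inE => /negbFE.
rewrite inE => vU.
pose a' c : assignment V := [ffun w => if w == v then c else a w].
pose xv : linform V := [ffun w => (w == v)%:R].
have da' c : derivable ((xv, c + 1) |: negated_assignment a U).
  have -> : (xv, c + 1) |: negated_assignment a U =
      negated_assignment (a' c) (v |: U).
    rewrite /negated_assignment imsetU1 ffunE eqxx; congr (_ |: _).
    apply: eq_in_imset => w wU; rewrite ffunE.
    by case: eqP wU vU => // -> ->.
  apply: IHm; rewrite -ltnS; apply: leq_trans Um; rewrite ltnS.
  apply: proper_card; rewrite properE; apply/andP; split.
    by apply/subsetP => w; rewrite !inE => /norP[].
  by apply/subsetPn; exists v; rewrite !inE ?eqxx.
(* Giving [v] the value 1 yields the premise with [xv = 0], and the value 0 the one with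
   [xv = 1]. *)
apply: (@derivable_resolve xv).
  by have := da' 1; rewrite addF2xx.
by have := da' 0; rewrite add0r.
Qed.

Lemma refutation_complete : (forall a, ~~ config_sat a F) ->
  exists s, refutation F s.
Proof.
(* For no variables at all, the negated assignment is the empty clause. *)
move=> /(@derivable_negated_assignment 0 set0)/(_ set0)[s [ps _]].
by rewrite /negated_assignment imset0 => ?; exists s; apply/andP.
Qed.

End Completeness.

(** * The ordering formula: unsatisfiability and the invariant *)

Section OrderingFormula.
Variable n : nat.
Implicit Types (a : assignment (ordvar n)) (lt : rel 'I_n).

Lemma Ordering_satP a : reflect
  (forall C, ordering_clause C -> clause_sat a C)
  (config_sat a (lincnf_of_cnf (Ordering n))).
Proof.
apply: (iffP forall_inP) => [aF C FC|aF _ /imsetP[C + ->]].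
  by rewrite -linclause_of_clauseP aF// imset_f// inE; apply/asboolP.
by rewrite inE linclause_of_clauseP => /asboolP/aF.
Qed.

(** Quantifying over variables makes the relation false on the diagonal, where no variable
    exists. *)
Definition assignment_rel a : rel 'I_n :=
  fun i j => [exists v, (val v == (i, j)) && (a v == 1)].

Lemma assignment_relE a i j (ij : i != j) :
  assignment_rel a i j = (a (xvar ij) == 1).
Proof.
apply/existsP/idP => [[v /andP[/eqP vij av]]|aij]; last first.
  by exists (xvar ij); rewrite eqxx.
by rewrite (_ : xvar ij = v)//; apply/val_inj.
Qed.

(** A model would be a strict order on a nonempty finite set in which every element has a
    predecessor. *)
Lemma Ordering_unsat a :
  (0 < n)%N -> ~~ config_sat a (lincnf_of_cnf (Ordering n)).
Proof.
move=> n0; apply/negP => /Ordering_satP aF.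
have irr : irreflexive (assignment_rel a).
  move=> i; apply/existsP => -[v /andP[/eqP vi _]].
  by have := valP v; rewrite vi eqxx.
have neq i j : assignment_rel a i j -> i != j.
  by apply: contraTneq => ->; rewrite irr.
have asym i j : assignment_rel a i j -> ~~ assignment_rel a j i.
  move=> aij; apply/negP => aji.
  have ij := neq _ _ aij; have ji := neq _ _ aji.
  have /exists_inP[l] := aF _ (Ordering_antisym ij ji).
  move: aij aji; rewrite (assignment_relE a ij) (assignment_relE a ji).
  move=> /eqP aij /eqP aji; rewrite !inE => /orP[]/eqP->;
    by rewrite /= ?aij ?aji oner_eq0.
have tr : transitive (assignment_rel a).
  move=> j i k aij ajk.
  have ik : i != k by apply: contraTneq ajk => <-; exact: asym.
  have ij := neq _ _ aij; have jk := neq _ _ ajk.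
  have /exists_inP[l] := aF _ (Ordering_trans ij jk ik).
  rewrite (assignment_relE a ik).
  move: aij ajk; rewrite (assignment_relE a ij) (assignment_relE a jk).
  move=> /eqP aij /eqP ajk; rewrite !inE -orbA => /or3P[]/eqP->;
    by rewrite /= ?aij ?ajk// eq_sym oner_eq0.
pose below i := [set j | assignment_rel a j i].
have [i _ imin] := @arg_minnP _ (Ordinal n0) predT (fun i => #|below i|) isT.
have /exists_inP[l /imsetP[v + ->] /= av] := aF _ (Ordering_pred i).
rewrite inE => /eqP vi; pose j := (val v).1.
have ji : assignment_rel a j i.
  by apply/existsP; exists v; rewrite av andbT -vi -surjective_pairing.
(* By transitivity everything below [j] is below [i], while [j] is below [i] but not below itself;
   this contradicts the minimal count at [i]. *)
have := imin j isT; rewrite leqNgt => /negP[]; apply: proper_card.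
rewrite properE; apply/andP; split.
  by apply/subsetP => k; rewrite !inE => /tr; apply.
by apply/subsetPn; exists j; rewrite inE ?irr.
Qed.

Lemma order_assignment_sat lt C : strict_total lt -> ordering_clause C ->
  clause_sat (order_assignment lt) C \/
  exists i, C = [set poslit v | v : ordvar n & (val v).2 == i].
Proof.
move=> [irr tr tot] [i j ij ji|i j ij ji|i j k ij jk ik|i];
  [left|left|left|by right; exists i].
- apply/exists_inP; have [lij|nij] := boolP (lt i j).
    exists (neglit (xvar ji)); rewrite ?inE ?eqxx ?orbT// ffunE /=.
    by case: (boolP (lt j i)) => // /(tr _ _ _ lij); rewrite irr.
  by exists (neglit (xvar ij)); rewrite ?inE ?eqxx// ffunE /= (negPf nij).
- apply/exists_inP; have /orP[lij|lji] := tot _ _ ij.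
    by exists (poslit (xvar ij)); rewrite ?inE ?eqxx// ffunE /= lij.
  by exists (poslit (xvar ji)); rewrite ?inE ?eqxx ?orbT// ffunE /= lji.
- apply/exists_inP; have [lij|nij] := boolP (lt i j); last first.
    by exists (neglit (xvar ij)); rewrite ?inE ?eqxx// ffunE /= (negPf nij).
  have [ljk|njk] := boolP (lt j k); last first.
    exists (neglit (xvar jk)); rewrite ?inE ?eqxx ?orbT//.
    by rewrite ffunE /= (negPf njk).
  exists (poslit (xvar ik)); rewrite ?inE ?eqxx ?orbT// ffunE /=.
  by rewrite (tr _ _ _ lij ljk).
Qed.

Lemma order_assignment_sat_pred lt i j : irreflexive lt -> lt j i ->
  clause_sat (order_assignment lt)
    [set poslit v | v : ordvar n & (val v).2 == i].
Proof.
move=> irr ji; have ne : j != i by apply: contraTneq ji => ->; rewrite irr.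
apply/exists_inP; exists (poslit (xvar ne)); last by rewrite ffunE /= ji.
by apply: imset_f; rewrite inE.
Qed.

(** The order has to change only when a predecessor clause is downloaded, and then
    [order_avoid_minimum] supplies a new one. *)
Lemma order_config_sat_step (S T : config (ordvar n)) lt :
  (2 * #|S| < n.-1)%N -> step (lincnf_of_cnf (Ordering n)) S T ->
  strict_total lt -> config_sat (order_assignment lt) S ->
  exists2 lt', strict_total lt' & config_sat (order_assignment lt') T.
Proof.
move=> Sn ST ltT satS.
have [satT|[D /imsetP[C + ->] ->]] := config_sat_step ST satS.
  by exists lt.
rewrite inE => /asboolP /(order_assignment_sat ltT)[satC|[i ->]].
  by exists lt => //; rewrite config_satU1 linclause_of_clauseP satC.
have [lt' [ltT' satS' [j ji]]] :=
  order_avoid_minimum i Sn ltT (fun C => forall_inP satS C).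
exists lt' => //; rewrite config_satU1 linclause_of_clauseP.
rewrite (order_assignment_sat_pred _ ji) /=; last by case: ltT'.
exact/forall_inP.
Qed.

Lemma ltn_strict_total : strict_total (fun i j : 'I_n => i < j)%N.
Proof.
split=> [i|j i k|i j]; [exact: ltnn | exact: ltn_trans | by rewrite -neq_ltn].
Qed.

Lemma Ordering_refutation_space (s : seq (config (ordvar n))) :
  refutation (lincnf_of_cnf (Ordering n)) s ->
  (n.-1 <= 2 * refutation_space s)%N.
Proof.
move=> /andP[]; rewrite leqNgt => ps last0; apply/negP => small.
have : forall S, S \in set0 :: s -> (2 * #|S| < n.-1)%N.
  move=> S Ss; apply: leq_ltn_trans small; rewrite leq_mul2l /=.
  exact: leq_bigmax_seq.
have : exists2 lt : rel 'I_n, strict_total lt &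
    config_sat (order_assignment lt) set0.
  by exists (fun i j => i < j)%N; [exact: ltn_strict_total|
    apply/forall_inP => C; rewrite inE].
(* Induction over the refutation from an arbitrary starting configuration; at its end, an order
   would satisfy the empty clause. *)
move: set0 ps last0 => S; elim: s S {small} => /= [|T s IHs] S.
  move=> _ S0 [lt _ /forall_inP/(_ _ S0)/exists_inP[e]].
  by rewrite inE.
move=> /andP[ST ps] last0 [lt ltT satS] small.
apply: IHs ps last0 _ _.
  by apply: order_config_sat_step satS; rewrite ?small ?mem_head.
by move=> U Us; apply: small; rewrite inE Us orbT.
Qed.

End OrderingFormula.

(** * The linear lower bound on space *)

Lemma ResLinSpace_Ordering_ge n :
  (n.-1 <= 2 * ResLinSpace (lincnf_of_cnf (Ordering n)))%N.
Proof.
case: n => [//|n].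
(* Some refutation exists, so [ResLinSpace] is the space of an actual refutation. *)
have [s Fs] : exists s, refutation (lincnf_of_cnf (Ordering n.+1)) s.
  by apply: refutation_complete => a; exact: Ordering_unsat.
by have [[t Ft <-] _] := ResLinSpaceP Fs; exact: Ordering_refutation_space.
Qed.

(* Imported only here: classical_sets shadows the {set T} names used above. *)
From mathcomp Require Import all_classical all_reals all_analysis.
Import numFieldNormedType.Exports.
Local Open Scope classical_set_scope.
Local Open Scope ring_scope.

Theorem theorem4p12 (R : realType) :
  (fun n : nat => (ResLinSpace (lincnf_of_cnf (Ordering n)))%:R : R)
    \is 'Omega_\oo (fun n : nat => n%:R : R).
Proof.
(* The constant combines [n <= 2 * n.-1], valid for [n > 1], with the factor 2 of
   [ResLinSpace_Ordering_ge]. *)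
rewrite qualifE; apply/asboolP; exists 4^-1; first by rewrite invr_gt0.
near=> n; rewrite !normr_nat ler_pdivrMl// -natrM ler_nat.
have n1 : (1 < n)%N by near: n; exact: nbhs_infty_gt.
apply: (@leq_trans (2 * n.-1)).
  by rewrite -{1}(prednK (ltnW n1)) mul2n -addnn -addn1 leq_add2l ltn_predRL.
by rewrite -[4%N]/(2 * 2)%N -mulnA leq_mul2l ResLinSpace_Ordering_ge.
Unshelve. all: by end_near.
Qed.
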